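(* Let $M$ be a finitely generated module over a commutative Noetherian ring $R$ and let $N$ be a submodule of $M$. Put $\mathfrak p=\operatorname{Rad}(N:_RM)$, and suppose that $\mathfrak pM\nsubseteq N$ and $\mathfrak p\notin\operatorname{Ass}_R(R/\operatorname{Ann}_R(M))$. Then $N$ is strongly irreducible if and only if $N$ is primary (so that $\mathfrak p$ is a prime ideal), $M_{\mathfrak p}$ is an arithmetical $R_{\mathfrak p}$-module and $N=(\mathfrak pM)^{(n)}$ for some integer $n>1$.
   Context: All rings are commutative with non-zero identity. A submodule $N$ of $M$ is strongly irreducible if for all submodules $K,L$ of $M$, $K\cap L\subseteq N$ implies $K\subseteq N$ or $L\subseteq N$. $N:_RM=\{r\in R: rM\subseteq N\}$, and $\operatorname{Rad}$ denotes the radical of an ideal. A proper submodule $N$ is primary if $rx\in N$ with $r\in R$, $x\in M\setminus N$ implies $r\in\operatorname{Rad}(N:_RM)$. A module over a ring $A$ is arithmetical if for each maximal ideal $\mathfrak m$ of $A$ the submodules of its localization at $\mathfrak m$ (over $A_{\mathfrak m}$) are linearly ordered by inclusion. For an ideal $\mathfrak a$ of $R$ and $n\ge 1$, $(\mathfrak aM)^{(n)}:=\bigcup_{s\in S}(\mathfrak a^nM:_Ms)$, where $S=R\setminus\bigcup\{\mathfrak q: \mathfrak q\in \mathrm{mAss}_R(M/\mathfrak aM)\}$, $\mathrm{mAss}_R(L)$ is the set of minimal elements of $\operatorname{Ass}_R(L)$, and $(K:_Ms)=\{x\in M: sx\in K\}$. *)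

(* Defs.v *)
From HB Require Import structures.
From mathcomp Require Import all_boot all_algebra boolp ring.

Set Implicit Arguments.
Unset Strict Implicit.
Unset Printing Implicit Defensive.

Import GRing.Theory.
Local Open Scope ring_scope.
Local Open Scope quotient_scope.

(* Submodules of M are the predicates N : submodClosed M; ideals of R are the
   submodules of R^o.  Sets of elements are classical predicates {pred M},
   equality of submodules is =i and inclusion is {subset _ <= _}. *)

Section Generation.
Variables (R : comNzRingType) (M : lmodType R).
Implicit Types (A N : {pred M}) (I : {pred R}).

Definition gen A : {pred M} :=
  [pred x | `[< forall K : submodClosed M, {subset A <= K} -> x \in K >]].

Lemma gen_closed A : subsemimod_closed (gen A).
Proof.
split; first split.
- by apply/asboolP => K _; exact: rpred0.
- move=> x y /asboolP hx /asboolP hy; apply/asboolP => K AK.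
  by rewrite rpredD ?hx ?hy.
- by move=> a x /asboolP hx; apply/asboolP => K AK; rewrite rpredZ ?hx.
Qed.
HB.instance Definition _ A :=
  GRing.isSubmodClosed.Build R M (gen A) (gen_closed A).

Definition ideal_mul I N : {pred M} :=
  gen [pred x | `[< exists r, exists y, [/\ r \in I, y \in N & x = r *: y] >]].

HB.instance Definition _ I N := GRing.SubmodClosed.copy (ideal_mul I N) (gen _).

Definition fin_gen N := exists s : seq M, N =i gen [in s].

End Generation.

Definition fin_gen_module (R : comNzRingType) (M : lmodType R) :=
  fin_gen (predT : {pred M}).

Definition noetherian (R : comNzRingType) :=
  forall I : submodClosed R^o, fin_gen I.

Definition ideal_pow (R : comNzRingType) (I : {pred R}) (n : nat) : {pred R} :=
  iter n (fun J : {pred R^o} => ideal_mul I J) predT.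

Definition radical (R : comNzRingType) (I : {pred R}) : {pred R} :=
  [pred r | `[< exists n : nat, r ^+ n \in I >]].

Definition colon (R : comNzRingType) (M : lmodType R) (N : {pred M}) :
    {pred R} :=
  [pred r | `[< forall x : M, r *: x \in N >]].

Definition annihilator (R : comNzRingType) (M : lmodType R) : {pred R^o} :=
  [pred r | `[< forall x : M, (r : R) *: x = 0 >]].

Lemma annihilator_closed (R : comNzRingType) (M : lmodType R) :
  subsemimod_closed (annihilator M).
Proof.
split; first split.
- by apply/asboolP => x; rewrite scale0r.
- move=> a b /asboolP ha /asboolP hb; apply/asboolP => x.
  by rewrite scalerDl ha hb addr0.
- move=> a b /asboolP hb; apply/asboolP => x.
  by rewrite -[a *: b]/((a : R) * (b : R)) -scalerA hb scaler0.
Qed.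
HB.instance Definition _ (R : comNzRingType) (M : lmodType R) :=
  GRing.isSubmodClosed.Build R R^o (annihilator M) (annihilator_closed M).

Section QuotientModule.
Variables (R : comNzRingType) (M : lmodType R) (N : submodClosed M).

Fact submod_oppr_closed : oppr_closed N.
Proof. by move=> x Nx; rewrite -scaleN1r rpredZ. Qed.

Definition zmod_of_submod : zmodClosed M :=
  HB.pack_for (zmodClosed M) (N : {pred M})
    (GRing.isOppClosed.Build M N submod_oppr_closed)
    (GRing.AddClosed.on (N : {pred M})).

Definition quot_module : Type := Quotient.quot zmod_of_submod.
HB.instance Definition _ := GRing.Zmodule.on quot_module.

Definition quot_scale (a : R) (q : quot_module) : quot_module :=
  \pi_(Quotient.quot zmod_of_submod)
    (a *: repr (q : Quotient.quot zmod_of_submod)).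

Lemma pi_scale a (x : M) :
  quot_scale a (\pi_(Quotient.quot zmod_of_submod) x)
    = \pi_(Quotient.quot zmod_of_submod) (a *: x).
Proof.
apply/eqP; rewrite /quot_scale piE Quotient.equivE -scalerBr.
apply: (@rpredZ _ _ N); rewrite -[_ \in N]/(_ \in zmod_of_submod).
by rewrite Quotient.idealrBE reprK.
Qed.

Fact quot_scalerA a b v : quot_scale a (quot_scale b v) = quot_scale (a * b) v.
Proof. by rewrite [quot_scale b v]/quot_scale pi_scale scalerA. Qed.
Fact quot_scale1r : left_id 1 quot_scale.
Proof. by move=> v; rewrite /quot_scale scale1r reprK. Qed.
Fact quot_scalerDr : right_distributive quot_scale +%R.
Proof.
move=> a u v.
rewrite -[u](@reprK _ (Quotient.quot zmod_of_submod)).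
rewrite -[v](@reprK _ (Quotient.quot zmod_of_submod)).
rewrite -[_ + _ in LHS](raddfD (\pi_(Quotient.quot zmod_of_submod))).
by rewrite !pi_scale scalerDr (raddfD (\pi_(Quotient.quot zmod_of_submod))).
Qed.
Fact quot_scalerDl v : {morph quot_scale^~ v : a b / a + b}.
Proof.
move=> a b; rewrite /quot_scale scalerDl.
by rewrite (raddfD (\pi_(Quotient.quot zmod_of_submod))).
Qed.

HB.instance Definition _ := GRing.Zmodule_isLmodule.Build R quot_module
  quot_scalerA quot_scale1r quot_scalerDr quot_scalerDl.

End QuotientModule.

Section Localization.
Variables (R : comNzRingType) (p : prime_idealr R).

Definition denom := {s : R | s \notin p}.

Fact denom1_subproof : 1 \notin p. Proof. by rewrite idealr1. Qed.
Definition denom1 : denom := exist (fun s => s \notin p) 1 denom1_subproof.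
Fact denomM_subproof (s t : denom) : val s * val t \notin p.
Proof. by rewrite prime_idealrM negb_or (valP s) (valP t). Qed.
Definition denomM (s t : denom) : denom :=
  exist (fun s => s \notin p) _ (denomM_subproof s t).

Section Module.
Variable M : lmodType R.

(* The pair (x, s) stands for the fraction x / s. *)
Definition frac_equiv (f g : M * denom) : bool :=
  `[< exists u : denom,
        (val u * val g.2) *: f.1 = (val u * val f.2) *: g.1 >].

Lemma frac_equiv_is_equiv : equiv_class_of frac_equiv.
Proof.
split.
- by move=> f; apply/asboolP; exists denom1.
- by move=> f g; apply/asboolP/asboolP => -[u e]; exists u.
- move=> g f h /asboolP[u e] /asboolP[v e']; apply/asboolP.
  exists (denomM (denomM u v) g.2); rewrite !SubK.
  rewrite (_ : _ * val h.2 = (val v * val h.2) * (val u * val g.2));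
    last by ring.
  rewrite -scalerA e scalerA.
  rewrite (_ : _ * (_ * _) = (val u * val f.2) * (val v * val h.2));
    last by ring.
  rewrite -scalerA e' scalerA; congr (_ *: _); ring.
Qed.

Canonical frac_equivRel := EquivRelPack frac_equiv_is_equiv.
Canonical frac_encModRel := defaultEncModRel frac_equiv.

Definition localization : Type := {eq_quot frac_equiv}.
HB.instance Definition _ := Choice.on localization.

Definition loc_frac (x : M) (s : denom) : localization :=
  \pi_{eq_quot frac_equiv} (x, s).
Definition numer_of (q : localization) : M :=
  (repr (q : {eq_quot frac_equiv})).1.
Definition denom_of (q : localization) : denom :=
  (repr (q : {eq_quot frac_equiv})).2.

Lemma loc_fracK q : loc_frac (numer_of q) (denom_of q) = q.
Proof.
rewrite /loc_frac /numer_of /denom_of -surjective_pairing.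
exact: (@reprK _ {eq_quot frac_equiv}).
Qed.

Lemma loc_fracP x s y t :
  loc_frac x s = loc_frac y t <->
  exists u : denom, (val u * val t) *: x = (val u * val s) *: y.
Proof.
split; first by move/eqmodP/asboolP.
by move=> h; apply/eqmodP/asboolP.
Qed.

Lemma frac_of x s : exists u : denom,
  (val u * val s) *: numer_of (loc_frac x s)
    = (val u * val (denom_of (loc_frac x s))) *: x.
Proof. exact/loc_fracP/loc_fracK. Qed.

Definition loc_zero : localization := loc_frac 0 denom1.
Definition loc_opp (q : localization) : localization :=
  loc_frac (- numer_of q) (denom_of q).
Definition loc_add (q r : localization) : localization :=
  loc_frac (val (denom_of r) *: numer_of q + val (denom_of q) *: numer_of r)
       (denomM (denom_of q) (denom_of r)).

Lemma loc_oppE x s : loc_opp (loc_frac x s) = loc_frac (- x) s.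
Proof.
have [u e] := frac_of x s.
by apply/loc_fracP; exists u; rewrite !scalerN e.
Qed.

Lemma loc_addE x s y t :
  loc_add (loc_frac x s) (loc_frac y t)
    = loc_frac (val t *: x + val s *: y) (denomM s t).
Proof.
have [u e] := frac_of x s; have [v f] := frac_of y t.
apply/loc_fracP; exists (denomM u v); rewrite !SubK.
set x' := numer_of _ in e *; set s' := denom_of _ in e *.
set y' := numer_of _ in f *; set t' := denom_of _ in f *.
rewrite !scalerDr !scalerA; congr (_ + _).
- rewrite (_ : _ * val t' = (val v * val t * val t') * (val u * val s));
    last by ring.
  by rewrite -scalerA e scalerA; congr (_ *: _); ring.
- rewrite (_ : _ * val s' = (val u * val s * val s') * (val v * val t));
    last by ring.
  by rewrite -scalerA f scalerA; congr (_ *: _); ring.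
Qed.

Lemma frac_eq x s y t : val t *: x = val s *: y -> loc_frac x s = loc_frac y t.
Proof. by move=> e; apply/loc_fracP; exists denom1; rewrite /= !mul1r. Qed.

Fact loc_addA : associative loc_add.
Proof.
move=> a b c; rewrite -[a]loc_fracK -[b]loc_fracK -[c]loc_fracK !loc_addE.
apply: frac_eq; rewrite !SubK !scalerDr !scalerA addrA.
by congr (_ + _ + _); congr (_ *: _); ring.
Qed.
Fact loc_addC : commutative loc_add.
Proof.
move=> a b; rewrite /loc_add; apply: frac_eq; rewrite !SubK addrC.
by rewrite [X in X *: _]mulrC.
Qed.
Fact loc_add0 : left_id loc_zero loc_add.
Proof.
move=> a; rewrite -[a]loc_fracK loc_addE; apply: frac_eq; rewrite !SubK.
by rewrite scaler0 add0r scale1r mul1r.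
Qed.
Fact loc_addN : left_inverse loc_zero loc_opp loc_add.
Proof.
move=> a; rewrite -[a]loc_fracK loc_oppE loc_addE; apply: frac_eq.
by rewrite scalerN addNr !scaler0.
Qed.

HB.instance Definition _ :=
  GRing.isZmodule.Build localization loc_addA loc_addC loc_add0 loc_addN.

End Module.

Definition loc_ring : Type := localization R^o.
HB.instance Definition _ := GRing.Zmodule.on loc_ring.

Section Scale.
Variable M : lmodType R.

Definition loc_scale (a : loc_ring) (q : localization M) : localization M :=
  loc_frac ((numer_of a : R) *: numer_of q) (denomM (denom_of a) (denom_of q)).

Lemma loc_scaleE (a : R) s (x : M) t :
  loc_scale (loc_frac (a : R^o) s) (loc_frac x t)
    = loc_frac (a *: x) (denomM s t).
Proof.
have [u e] := frac_of (a : R^o) s; have [v f] := frac_of x t.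
apply/loc_fracP; exists (denomM u v); rewrite !SubK.
set a' := numer_of _ in e *; set s' := denom_of _ in e *.
set x' := numer_of _ in f *; set t' := denom_of _ in f *.
have {}e : val u * val s * (a' : R) = val u * val s' * a by [].
rewrite !scalerA.
rewrite (_ : _ * a' = (val u * val s * (a' : R)) * (val v * val t));
    last by ring.
rewrite -scalerA f e scalerA; congr (_ *: _); ring.
Qed.

End Scale.

Definition loc_one : loc_ring := loc_frac (1 : R^o) denom1.
Definition loc_mul (a b : loc_ring) : loc_ring := @loc_scale R^o a b.

Lemma loc_mulE (a b : R) s t :
  loc_mul (loc_frac (a : R^o) s) (loc_frac (b : R^o) t)
    = loc_frac (a * b : R^o) (denomM s t).
Proof. exact: loc_scaleE. Qed.

Section ScaleTheory.
Variable M : lmodType R.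

Fact loc_scaleA a b (v : localization M) :
  loc_scale a (loc_scale b v) = loc_scale (loc_mul a b) v.
Proof.
rewrite -[a]loc_fracK -[b]loc_fracK -[v]loc_fracK loc_mulE.
rewrite (loc_scaleE (numer_of b) _ (numer_of v)) !loc_scaleE.
by apply: frac_eq; rewrite !SubK !scalerA; congr (_ *: _); ring.
Qed.
Fact loc_scale1 : left_id loc_one (@loc_scale M).
Proof.
move=> v; rewrite -[v]loc_fracK /loc_one loc_scaleE.
by apply: frac_eq; rewrite !SubK scale1r mul1r.
Qed.
Fact loc_scaleDr : right_distributive (@loc_scale M) +%R.
Proof.
move=> a u v; rewrite -[a]loc_fracK -[u]loc_fracK -[v]loc_fracK.
rewrite -![_ + _]/(loc_add _ _).
rewrite (loc_addE (numer_of u)) !(loc_scaleE (numer_of a)) loc_addE.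
apply: frac_eq; rewrite !SubK !scalerDr !scalerA.
by congr (_ *: _ + _ *: _); ring.
Qed.
Fact loc_scaleDl (v : localization M) :
  {morph (@loc_scale M)^~ v : a b / a + b}.
Proof.
move=> a b; rewrite -[a]loc_fracK -[b]loc_fracK -[v]loc_fracK.
rewrite -![_ + _]/(loc_add _ _).
rewrite (loc_addE (numer_of a)) !(loc_scaleE _ _ (numer_of v)) loc_addE.
apply: frac_eq; rewrite !SubK scalerDl !scalerDr !scalerA.
by congr (_ *: _ + _ *: _); rewrite /GRing.scale/=; ring.
Qed.

End ScaleTheory.

Fact loc_mulC : commutative loc_mul.
Proof.
move=> a b; rewrite -[a]loc_fracK -[b]loc_fracK !loc_mulE.
by apply: frac_eq; rewrite !SubK /GRing.scale/=; ring.
Qed.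

Fact loc_one_neq0 : loc_one != 0.
Proof.
apply/eqP => /loc_fracP[u] /=; rewrite scaler0 /GRing.scale/= => h.
by have := valP u; rewrite -[val u]mulr1 -[val u * 1]mulr1 h idealr0.
Qed.

HB.instance Definition _ := GRing.Zmodule_isComNzRing.Build loc_ring
  (@loc_scaleA R^o) loc_mulC (@loc_scale1 R^o)
  (fun a b c => @loc_scaleDl R^o c a b) loc_one_neq0.

HB.instance Definition _ (M : lmodType R) :=
  GRing.Zmodule_isLmodule.Build loc_ring (localization M)
    (@loc_scaleA M) (@loc_scale1 M) (@loc_scaleDr M) (@loc_scaleDl M).

End Localization.

(* idealr only contains proper ideals *)
Definition maximal_ideal (A : comNzRingType) (m : idealr A) :=
  forall J : idealr A, {subset m <= J} -> J =i m.

Lemma maximal_ideal_prime (A : comNzRingType) (m : idealr A) :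
  maximal_ideal m -> prime_idealr_closed m.
Proof.
move=> hm u v uvm; have [//|um /=] := boolP (u \in m).
pose J : {pred A} := [pred x | `[< exists r, x - r * u \in m >]].
have [J1|J1] := boolP (1 \in J).
  have /asboolP[r hr] := J1.
  have := rpredD (idealMr v hr) (idealMr r uvm).
  by congr (_ \in m); ring.
have hJ : idealr_closed J.
  split=> //.
    by apply/asboolP; exists 0; rewrite mul0r subr0 idealr0.
  move=> a x y /asboolP[r hr] /asboolP[r' hr']; apply/asboolP.
  exists (a * r + r'); have := rpredD (idealMr a hr) hr'.
  by congr (_ \in m); ring.
pose J' : idealr A := HB.pack_for (idealr A) J (isIdealr.Build A J hJ).
have mJ : {subset m <= J'}.
  by move=> x xm; apply/asboolP; exists 0; rewrite mul0r subr0.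
have := hm J' mJ u; rewrite (negPf um) => /negP[]; apply/asboolP.
by exists 1; rewrite mul1r subrr idealr0.
Qed.

Definition prime_of_maximal (A : comNzRingType) (m : idealr A)
    (hm : maximal_ideal m) : prime_idealr A :=
  HB.pack_for (prime_idealr A) (m : {pred A})
    (isPrimeIdealrClosed.Build A m (maximal_ideal_prime hm))
    (Idealr.on (m : {pred A})).

Definition uniserial (A : comNzRingType) (L : lmodType A) :=
  forall K K' : submodClosed L, {subset K <= K'} \/ {subset K' <= K}.

Definition arithmetical (A : comNzRingType) (L : lmodType A) :=
  forall (m : idealr A) (hm : maximal_ideal m),
    uniserial (localization (prime_of_maximal hm) L).

Definition associated_prime (R : comNzRingType) (L : lmodType R)
    (q : {pred R}) :=
  [/\ idealr_closed q, prime_idealr_closed q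
    & exists x : L, forall r, r \in q <-> r *: x = 0].

Definition minimal_associated_prime (R : comNzRingType) (L : lmodType R)
    (q : {pred R}) :=
  associated_prime L q /\
  forall q' : {pred R}, associated_prime L q' -> {subset q' <= q} -> q' =i q.

Section SymbolicPower.
Variables (R : comNzRingType) (M : lmodType R) (a : {pred R}).

Definition symbolic_denom (s : R) :=
  forall q : {pred R},
    minimal_associated_prime (quot_module (ideal_mul a (predT : {pred M}))) q ->
    s \notin q.

Definition symbolic_power (n : nat) : {pred M} :=
  [pred x | `[< exists2 s : R, symbolic_denom s
                  & s *: x \in ideal_mul (ideal_pow a n) predT >]].

End SymbolicPower.
Arguments symbolic_power {R} M a n.

Definition strongly_irreducible (R : comNzRingType) (M : lmodType R)
    (N : {pred M}) :=
  forall K L : submodClosed M, {subset [predI K & L] <= N} ->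
    {subset K <= N} \/ {subset L <= N}.

Definition primary (R : comNzRingType) (M : lmodType R) (N : {pred M}) :=
  (exists x : M, x \notin N) /\
  forall (r : R) (x : M), r *: x \in N -> x \notin N ->
    r \in radical (colon N).

(* Main.v *)
(* Localize at p, so that R is local and N is p-primary.  Strong irreducibility
   forces every submodule not contained in N to contain (N : p).  Call c
   "dominated" when (N : c) has this property.  Since p is not associated to
   R/Ann M, some w in p is not nilpotent on M, and then the property passes
   from (N : c) to (N : zc) for every z in p with zcM not inside N.  Taking c
   with (N : cM) maximal among the dominated c for which pcM is not inside N,
   one finds pM inside (N : zc), whence M = Ry and pM = zM.  By noetherian
   induction every nonzero element of M is then z^n y up to a unit, so M is
   uniserial and N = p^n M.  All of this is carried out in M itself, elements
   outside p playing the role of units. *)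
From HB Require Import structures.
Require Import Defs.
From mathcomp Require Import all_boot all_algebra.
From mathcomp Require Import boolp ring.

Set Implicit Arguments.
Unset Strict Implicit.
Unset Printing Implicit Defensive.

Import GRing.Theory.
Local Open Scope ring_scope.

(** * Noetherian rings *)

Definition pack_submod (R : comNzRingType) (M : lmodType R) (K : {pred M})
    (hK : subsemimod_closed K) : submodClosed M :=
  HB.pack_for (submodClosed M) K (GRing.isSubmodClosed.Build R M K hK).

Definition multiples (R : comNzRingType) (M : lmodType R) (x : M) : {pred M} :=
  [pred y | `[< exists r : R, y = r *: x >]].

Lemma multiples_closed (R : comNzRingType) (M : lmodType R) (x : M) :
  subsemimod_closed (multiples x).
Proof.
split; first split.
- by apply/asboolP; exists 0; rewrite scale0r.
- move=> _ _ /asboolP[a ->] /asboolP[b ->]; apply/asboolP.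
  by exists (a + b); rewrite scalerDl.
- move=> a _ /asboolP[b ->]; apply/asboolP.
  by exists (a * b); rewrite scalerA.
Qed.
HB.instance Definition _ (R : comNzRingType) (M : lmodType R) (x : M) :=
  GRing.isSubmodClosed.Build R M (multiples x) (multiples_closed x).

Lemma multiples_id (R : comNzRingType) (M : lmodType R) (x : M) :
  x \in multiples x.
Proof. by apply/asboolP; exists 1; rewrite scale1r. Qed.

Lemma mem_gen (R : comNzRingType) (M : lmodType R) (A : {pred M}) :
  {subset A <= gen A}.
Proof. by move=> x Ax; apply/asboolP => K; apply. Qed.

Lemma gen_sub (R : comNzRingType) (M : lmodType R) (A : {pred M})
    (K : submodClosed M) : {subset A <= K} -> {subset gen A <= K}.
Proof. by move=> AK x /asboolP; apply. Qed.

(** Without a maximal member, choice builds a strictly ascending chain. Its union is an ideal whose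
    finitely many generators already lie in one term. The family is indexed by [T] so that
    maximality selects a ring or module element, not merely its ideal. *)
Lemma noetherian_maximal (R : comNzRingType) (T : Type) (F : T -> Prop)
    (I : T -> {pred R^o}) :
    noetherian R -> (forall t, F t -> subsemimod_closed (I t)) ->
    (exists t, F t) ->
  exists2 t, F t &
    forall t', F t' -> {subset I t <= I t'} -> {subset I t' <= I t}.
Proof.
move=> noethR Iclosed [t0 Ft0]; apply: contrapT => nomax.
have /choice[g gP] (t : {t | F t}) : exists t' : {t | F t},
    {subset I (sval t) <= I (sval t')}
    /\ ~ {subset I (sval t') <= I (sval t)}.
  case: t => t Ft /=; apply: contrapT => H; apply: nomax; exists t => // t' Ft'.
  move=> sub; apply: contrapT => nsub; apply: H.
  by exists (exist _ t' Ft').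
pose u n := sval (iter n g (exist _ t0 Ft0)).
have uF n : F (u n) by exact: svalP.
have uS n : {subset I (u n) <= I (u n.+1)}.
  by case: (gP (iter n g (exist _ t0 Ft0))).
have umono m n : (m <= n)%N -> {subset I (u m) <= I (u n)}.
  move=> /subnK <-; elim: (n - m)%N => [|k IH] x; first by rewrite add0n.
  by move=> /IH; rewrite addSn; apply: uS.
pose U : {pred R^o} := [pred r | `[< exists n, r \in I (u n) >]].
have Uclosed : subsemimod_closed U.
  split; first split.
  - by apply/asboolP; exists 0; case: (Iclosed _ (uF 0)) => -[].
  - move=> x y /asboolP[m xm] /asboolP[n yn]; apply/asboolP.
    exists (maxn m n); case: (Iclosed _ (uF (maxn m n))) => -[_ + _]; apply.
      exact: umono (leq_maxl _ _) _ xm.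
    exact: umono (leq_maxr _ _) _ yn.
  - move=> a x /asboolP[n xn]; apply/asboolP; exists n.
    by case: (Iclosed _ (uF n)) => _; apply.
have [s Us] := noethR (pack_submod Uclosed).
have [n sn] : exists n, forall r, r \in s -> r \in I (u n).
  have : forall r, r \in s -> r \in U.
    by move=> r rs; have := Us r => ->; apply: mem_gen.
  elim: s {Us} => [|r s IH] sU; first by exists 0.
  have [m sm] := IH (fun r' r's => sU r' (mem_behead (s := r :: s) r's)).
  have /asboolP[n rn] := sU r (mem_head _ _).
  exists (maxn m n) => r'; rewrite inE => /predU1P[->|/sm].
    exact: umono (leq_maxr _ _) _ rn.
  exact: umono (leq_maxl _ _) _.
have [_ []] := gP (iter n g (exist _ t0 Ft0)).
move=> r rn; have rU : r \in U by apply/asboolP; exists n.+1.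
have := Us r; rewrite [LHS]rU => /esym.
exact: (@gen_sub _ _ _ (pack_submod (Iclosed _ (uF n)))).
Qed.

Lemma idealr_submod (R : comNzRingType) (P : idealr R) :
  subsemimod_closed (P : {pred R^o}).
Proof.
split; first split; first exact: idealr0.
  by move=> x y; apply: rpredD.
by move=> a x; apply: idealMr.
Qed.

(** The product of the denominators of the generators serves them all, and the elements that it
    sends into [K] form a submodule. *)
Lemma gen_common_denom (R : comNzRingType) (P : prime_idealr R)
    (M : lmodType R) (A : seq M) (K : submodClosed M) :
    (forall x, x \in A -> exists2 s, s \notin P & s *: x \in K) ->
  exists2 s, s \notin P & forall x, x \in gen [in A] -> s *: x \in K.
Proof.
move=> AK.
have [s sP sA] : exists2 s, s \notin P & forall x, x \in A -> s *: x \in K.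
  elim: A AK => [|x A IH] AK; first by exists 1; rewrite ?idealr1.
  have [|s sP sA] := IH; first by move=> y yA; apply: AK; rewrite inE yA orbT.
  have [t tP tx] := AK x (mem_head _ _).
  exists (s * t); first by rewrite prime_idealrM negb_or sP tP.
  move=> y; rewrite inE => /predU1P[->|/sA sy].
    by rewrite -scalerA rpredZ.
  by rewrite mulrC -scalerA rpredZ.
exists s => // x.
pose K' : {pred M} := [pred y | s *: y \in K].
have K'closed : subsemimod_closed K'.
  split; first split.
  - by rewrite inE scaler0 rpred0.
  - by move=> y z; rewrite !inE scalerDr; apply: rpredD.
  - by move=> a y; rewrite !inE scalerA mulrC -scalerA; apply: rpredZ.
exact: (@gen_sub _ _ _ (pack_submod K'closed)).
Qed.

(** Take [c] outside [I] with (I : c) maximal. If z^(n+1) is the least power of [z] sending [c] into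
    [I], then z^n c is outside [I], so (I : z^n c), which contains [z], is no larger than (I :
    c). *)
Lemma nilpotent_socle (R : comNzRingType) (I : submodClosed R^o)
    (P : {pred R}) :
    noetherian R -> 1 \notin I ->
    (forall z, z \in P -> exists n, z ^+ n \in (I : {pred R})) ->
  exists2 c : R, c \notin I & forall z, z \in P -> z * c \in (I : {pred R}).
Proof.
move=> noethR I1 nilP.
have IMr (a b : R) : b \in I -> a * b \in (I : {pred R}) := @rpredZ _ _ I a b.
pose colon_at (c : R) : {pred R^o} := [pred r : R | r * c \in (I : {pred R})].
have [|||c cI cmax] := @noetherian_maximal R R (fun c => c \notin I) colon_at.
- by [].
- move=> c _; split; first split.
  + by rewrite inE mul0r; apply: (@rpred0 _ I).
  + by move=> x y; rewrite !inE mulrDl; apply: (@rpredD _ I).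
  + by move=> a x; rewrite !inE -[a *: x]/(a * x) -mulrA; apply: IMr.
- by exists 1.
exists c => // z zP; apply: contrapT => zcI.
have nilc : exists n, z ^+ n * c \in (I : {pred R}).
  by have [n zn] := nilP z zP; exists n; rewrite mulrC IMr.
case: (ex_minnP nilc) => -[|n] znc nmin.
  by move: cI; rewrite -[c]mul1r -(expr0 z) znc.
have cI' : z ^+ n * c \notin I.
  by apply/negP => /nmin; rewrite ltnn.
apply: zcI; apply: (cmax (z ^+ n * c)) => //.
  by move=> r; rewrite !inE mulrCA; apply: IMr.
by rewrite inE mulrA -exprS.
Qed.

(** * Localization at a prime *)

Section LocalMultiples.
Variables (R : comNzRingType) (P : prime_idealr R) (M : lmodType R).

(* x/1 is a multiple of y/1 in the localization of M at P *)
Definition loc_mult (x y : M) :=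
  exists2 s, s \notin P & exists r : R, s *: x = r *: y.

Lemma notin_primeM (s t : R) : s \notin P -> t \notin P -> s * t \notin P.
Proof. by rewrite prime_idealrM negb_or => -> ->. Qed.

Lemma loc_mult_multiple (a : R) x : loc_mult (a *: x) x.
Proof. by exists 1; [rewrite idealr1 | exists a; rewrite scale1r]. Qed.

Lemma loc_mult_refl x : loc_mult x x.
Proof. by rewrite -{1}[x]scale1r; apply: loc_mult_multiple. Qed.

Lemma loc_mult_trans y x z : loc_mult x y -> loc_mult y z -> loc_mult x z.
Proof.
move=> [s sP [a xy]] [t tP [b yz]]; exists (s * t); first exact: notin_primeM.
exists (a * b); rewrite [s * t]mulrC -!scalerA xy -yz !scalerA.
by rewrite [t * a]mulrC.
Qed.

Lemma loc_multZ (a : R) x y : loc_mult x y -> loc_mult (a *: x) (a *: y).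
Proof.
move=> [s sP [r e]]; exists s => //; exists r.
by rewrite !scalerA [s * a]mulrC [r * a]mulrC -!scalerA e.
Qed.

Lemma loc_multB x x' y : loc_mult x y -> loc_mult x' y -> loc_mult (x - x') y.
Proof.
move=> [s sP [a xy]] [t tP [b x'y]]; exists (s * t); first exact: notin_primeM.
exists (t * a - s * b); rewrite scalerBr scalerBl -!scalerA -x'y -xy.
by rewrite scalerA mulrC -scalerA.
Qed.

Lemma loc_mult_unit s x : s \notin P -> loc_mult x (s *: x).
Proof. by move=> sP; exists s => //; exists 1; rewrite scale1r. Qed.

End LocalMultiples.

(** Uniseriality of the localization at [P], expressed on elements of [M] without fractions. *)
Definition comparable_at (R : comNzRingType) (P : prime_idealr R)
    (M : lmodType R) :=
  forall x y : M, loc_mult P x y \/ loc_mult P y x.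

Section Comparable.
Variables (R : comNzRingType) (P : prime_idealr R).

Lemma scale_fracE (M : lmodType R) (a : R) (s t : denom P) (x : M) :
  (loc_frac (a : R^o) s : loc_ring P) *: (loc_frac x t : localization P M)
    = loc_frac (a *: x) (denomM s t).
Proof. exact: loc_scaleE. Qed.

Lemma loc_mult_frac (M : lmodType R) (x y : M) (t u : denom P) :
  loc_mult P x y ->
  exists b : loc_ring P,
    (loc_frac x t : localization P M) = b *: (loc_frac y u : localization P M).
Proof.
case=> s sP [r e]; pose s' : denom P := exist (fun s => s \notin P) s sP.
exists (loc_frac (val u * r : R^o) (denomM t s')).
rewrite scale_fracE; apply: frac_eq => /=.
rewrite -scalerA -e !scalerA; congr (_ *: _); ring.
Qed.

Lemma comparable_loc (M : lmodType R) : comparable_at P M ->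
  forall v w : localization P M,
    exists b : loc_ring P, v = b *: w \/ w = b *: v.
Proof.
move=> cmpM v w; rewrite -[v]loc_fracK -[w]loc_fracK.
have [vw|wv] := cmpM (numer_of v) (numer_of w).
  by have [b eb] := loc_mult_frac (denom_of v) (denom_of w) vw; exists b; left.
by have [b eb] := loc_mult_frac (denom_of w) (denom_of v) wv; exists b; right.
Qed.

(** One direction compares the cyclic submodules of x/1 and y/1. For the other, an element [v] of
    [K] outside [K'] is a multiple of no element of [K'], so every element of [K'] is a multiple of
    [v]. *)
Lemma uniserial_comparable (M : lmodType R) :
  uniserial (localization P M) <-> comparable_at P M.
Proof.
split.
- move=> uni x y.
  have frac_eq1 (a b : M) :
      (loc_frac a (denom1 P) : localization P M)
        \in multiples (loc_frac b (denom1 P) : localization P M) ->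
      loc_mult P a b.
    case/asboolP => c; rewrite -[c]loc_fracK scale_fracE => /loc_fracP[u /=].
    rewrite !mulr1 scalerA => e.
    exists (val u * val (denom_of c)); last first.
      by exists (val u * (numer_of c : R)).
    by rewrite prime_idealrM negb_or (valP u) (valP (denom_of c)).
  case: (uni (multiples (loc_frac x (denom1 P) : localization P M))
             (multiples (loc_frac y (denom1 P) : localization P M))) => sub.
    by left; apply/frac_eq1/sub/multiples_id.
  by right; apply/frac_eq1/sub/multiples_id.
- move=> cmpM K K'.
  have [sub|/existsNP[v nv]] := pselect {subset K <= K'}; first by left.
  have [vK vK'] : v \in K /\ v \notin K'.
    by move: nv => /not_implyP[vK /negP vK'].
  right=> w wK'; have [b [e|e]] := comparable_loc cmpM v w.
    by move: vK'; rewrite e rpredZ.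
  by rewrite e rpredZ.
Qed.

Definition loc_max : {pred loc_ring P} := [pred q : loc_ring P |
  `[< exists a : R, exists2 s : denom P, a \in P & q = loc_frac (a : R^o) s >]].

Lemma mem_loc_max (a : R) (s : denom P) :
  ((loc_frac (a : R^o) s : loc_ring P) \in loc_max) = (a \in P).
Proof.
apply/asboolP/idP => [[b [t bP /loc_fracP[u e]]]|aP]; last by exists a, s.
have {}e : val u * val t * a = val u * val s * b := e.
have : val u * val t * a \in P by rewrite e idealMr.
by rewrite !prime_idealrM (negPf (valP u)) (negPf (valP t)).
Qed.

Lemma loc_max_closed : idealr_closed loc_max.
Proof.
split.
- by rewrite (mem_loc_max 0) idealr0.
- by rewrite [1]/(loc_frac (1 : R^o) (denom1 P)) mem_loc_max idealr1.
- move=> q v w; rewrite -[q]loc_fracK -[v]loc_fracK -[w]loc_fracK.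
  move=> vP wP; rewrite mem_loc_max in vP; rewrite mem_loc_max in wP.
  rewrite -[_ \in _]/((loc_add (loc_mul _ _) _ : loc_ring P) \in loc_max).
  rewrite loc_mulE loc_addE.
  by rewrite mem_loc_max; apply: rpredD; rewrite ?idealMr.
Qed.

Definition loc_max_ideal : idealr (loc_ring P) :=
  HB.pack_for (idealr (loc_ring P)) loc_max
    (isIdealr.Build (loc_ring P) loc_max loc_max_closed).

Lemma loc_max_maximal : maximal_ideal loc_max_ideal.
Proof.
move=> J mJ q; apply/idP/idP => [|/mJ//].
rewrite -[q]loc_fracK; set a : R := numer_of q; set s := denom_of q.
move=> qJ; rewrite mem_loc_max; apply: contrapT => /negP aP.
pose a' : denom P := exist (fun s => s \notin P) a aP.
have /negP[] := negbT (idealr1 J).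
have := idealMr (loc_frac (val s : R^o) a' : loc_ring P) qJ.
rewrite -[_ * _]/(loc_mul _ _) loc_mulE; congr (_ \in J).
by apply: frac_eq; rewrite /= /GRing.scale /=; ring.
Qed.

End Comparable.

(** One direction localizes at [loc_max_ideal] and clears two layers of denominators. For the other,
    any two fractions are already comparable in the localization at [P], and this survives
    localizing again at any maximal ideal. *)
Lemma arithmetical_localization (R : comNzRingType) (P : prime_idealr R)
    (M : lmodType R) :
  arithmetical (localization P M) <-> comparable_at P M.
Proof.
split=> [arith x y|cmpM m hm].
- have down (a b : M) :
      loc_mult (prime_of_maximal (@loc_max_maximal R P))
        (loc_frac a (denom1 P) : localization P M)
        (loc_frac b (denom1 P) : localization P M) ->
      loc_mult P a b.
    case=> c cm [d]; move: cm; rewrite -[c]loc_fracK -[d]loc_fracK !scale_fracE.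
    rewrite -[_ \in _]/(_ \in @loc_max R P) mem_loc_max => cP /loc_fracP[u] /=.
    rewrite !mulr1 !scalerA => e.
    exists (val u * val (denom_of d) * (numer_of c : R)).
      by rewrite !prime_idealrM !negb_or (valP u) (valP (denom_of d)).
    by exists (val u * val (denom_of c) * (numer_of d : R)).
  have := (uniserial_comparable _ _).1 (arith _ (@loc_max_maximal R P)).
  by move=> /(_ (loc_frac x (denom1 P)) (loc_frac y (denom1 P)))[] /down;
    [left|right].
- apply/uniserial_comparable => v w.
  have [b [->|->]] := comparable_loc cmpM v w.
    by left; exact: loc_mult_multiple.
  by right; exact: loc_mult_multiple.
Qed.

(** * Primary and strongly irreducible submodules *)

Section PrimarySubmodules.
Variables (R : comNzRingType) (M : lmodType R) (N : submodClosed M).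
Implicit Types (r : R) (x : M).

Lemma radical_exp r : r \in radical (colon N) ->
  exists n, forall x, r ^+ n *: x \in N.
Proof. by case/asboolP => n /asboolP; exists n. Qed.

Lemma radical_last_exp r x : r \in radical (colon N) -> x \notin N ->
  exists2 n, r ^+ n *: x \notin N & r *: (r ^+ n *: x) \in N.
Proof.
move=> /radical_exp[n rn] xN.
have ex : exists n, r ^+ n *: x \in N by exists n.
case: (ex_minnP ex) => -[|m] rm mmin.
  by move: xN; rewrite -[x]scale1r -(expr0 r) rm.
exists m; last by rewrite scalerA -exprS.
by apply/negP => /mmin; rewrite ltnn.
Qed.

(** Powers of a sum are never expanded: one finds an element outside [N] that both summands send
    into [N], and primarity puts the sum in the radical. For a product, the last power of uv keeping
    [x0] outside [N] is tested against [v], then [u]. *)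
Lemma primary_radical_closed : primary N ->
  idealr_closed (radical (colon N)) /\ prime_idealr_closed (radical (colon N)).
Proof.
move=> [[x0 x0N] prN].
have mulrP a r : r \in radical (colon N) -> a * r \in radical (colon N).
  move=> /radical_exp[n rn]; apply/asboolP; exists n; apply/asboolP => x.
  by rewrite exprMn -scalerA rpredZ.
split; first split.
- apply/asboolP; exists 1; apply/asboolP => x.
  by rewrite expr1 scale0r rpred0.
- apply/negP => /radical_exp[n /(_ x0)].
  by rewrite expr1n scale1r; apply/negP.
- move=> a u v uP vP.
  have [i uiN uiN'] := radical_last_exp (mulrP a u uP) x0N.
  have [j vjN vjN'] := radical_last_exp vP uiN.
  apply: (prN _ _ _ vjN); rewrite scalerDl rpredD //.
  by rewrite scalerA mulrC -scalerA rpredZ.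
- move=> u v uvP; have [i uiN uiN'] := radical_last_exp uvP x0N.
  have [vN|vN] := boolP (v *: ((u * v) ^+ i *: x0) \in N).
    by rewrite (prN _ _ vN uiN) orbT.
  by apply/orP; left; apply: (prN u _ _ vN); rewrite [u *: _]scalerA.
Qed.

Lemma fin_gen_radical r : fin_gen_module M ->
  (forall x, exists n, r ^+ n *: x \in N) -> r \in radical (colon N).
Proof.
move=> [s sM] rN.
have [n rn] : exists n, forall x, x \in s -> r ^+ n *: x \in N.
  elim: s {sM} => [|x s [n IH]]; first by exists 0.
  have [m rm] := rN x; exists (m + n)%N => y; rewrite inE.
  case/predU1P => [->|ys]; last by rewrite exprD -scalerA rpredZ ?IH.
  by rewrite addnC exprD -scalerA rpredZ.
apply/asboolP; exists n; apply/asboolP => x.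
pose K : {pred M} := [pred y | r ^+ n *: y \in N].
have Kclosed : subsemimod_closed K.
  split; first split.
  - by rewrite inE scaler0 rpred0.
  - by move=> y z; rewrite !inE scalerDr; apply: rpredD.
  - by move=> a y; rewrite !inE scalerA mulrC -scalerA; apply: rpredZ.
have : x \in gen [in s] by have := sM x => <-.
exact: (@gen_sub _ _ _ (pack_submod Kclosed)).
Qed.

(** The ideals (N : r^n y) stop growing at some n. If b r^n y = a x, then b r^(n+1) y = a r x is in
    [N], hence so is b r^n y. Thus the cyclic submodules of r^n y and [x] meet inside [N], and since
    [x] is outside, r^n y is in [N]. *)
Lemma strongly_irreducible_primary :
    noetherian R -> fin_gen_module M -> (exists x, x \notin N) ->
  strongly_irreducible N -> primary N.
Proof.
move=> noethR fgM propN siN; split=> // r x rxN xN.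
apply: fin_gen_radical => // y.
pose I n : {pred R^o} := [pred b : R | b *: (r ^+ n *: y) \in N].
have [||n _ nmax] := @noetherian_maximal R nat (fun=> True) I noethR.
- move=> n _; split; first split.
  + by rewrite inE scale0r rpred0.
  + by move=> a b; rewrite !inE scalerDl; apply: rpredD.
  + by move=> a b; rewrite !inE -[a *: b]/((a : R) * b) -scalerA; apply: rpredZ.
- by exists 0.
have [|sub|sub] := siN (multiples (r ^+ n *: y)) (multiples x).
- move=> _ /andP[/asboolP[b ->] /asboolP[a e]].
  apply: (nmax n.+1) => //.
    move=> c; rewrite !inE => cN.
    by rewrite exprS -scalerA scalerA mulrC -scalerA rpredZ.
  rewrite inE exprS -scalerA scalerA mulrC -scalerA e scalerA mulrC -scalerA.
  exact: rpredZ.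
- by exists n; apply: sub; exact: multiples_id.
- by move: xN; rewrite sub ?multiples_id.
Qed.

Lemma primary_cancel (P : prime_idealr R) s x :
    P =i radical (colon N) -> primary N ->
  s \notin P -> s *: x \in N -> x \in N.
Proof.
move=> PE prN sP sxN; apply: contrapT => /negP xN.
by move: sP; rewrite PE (prN.2 _ _ sxN xN).
Qed.

Lemma loc_mult_mem (P : prime_idealr R) x y :
    P =i radical (colon N) -> primary N ->
  loc_mult P x y -> y \in N -> x \in N.
Proof.
move=> PE prN [s sP [r e]] yN.
by apply: (primary_cancel PE prN sP); rewrite e rpredZ.
Qed.

(** Given x in [K] and y in [L], both outside [N], comparability puts sx or sy, with s outside [P],
    in the intersection and so in [N], against primarity. *)
Lemma comparable_strongly_irreducible (P : prime_idealr R) :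
    primary N -> P =i radical (colon N) -> comparable_at P M ->
  strongly_irreducible N.
Proof.
move=> [_ prN] PE cmpM K L KLN.
have [|/existsNP[x nx]] := pselect {subset K <= N}; first by left.
have [|/existsNP[y ny]] := pselect {subset L <= N}; first by right.
move/not_implyP: nx => [xK /negP xN]; move/not_implyP: ny => [yL /negP yN].
have [[s sP [r e]]|[s sP [r e]]] := cmpM x y.
  have /(prN _ _)/(_ xN) : s *: x \in N.
    by apply: KLN; rewrite !inE rpredZ // e rpredZ.
  by rewrite -PE (negPf sP).
have /(prN _ _)/(_ yN) : s *: y \in N.
  by apply: KLN; rewrite !inE [s *: y \in L]rpredZ // e rpredZ.
by rewrite -PE (negPf sP).
Qed.

End PrimarySubmodules.

(** * Associated primes *)

Section QuotientModuleTheory.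
Local Open Scope quotient_scope.
Variables (R : comNzRingType) (M : lmodType R) (N : submodClosed M).

Definition quot_pi (x : M) : quot_module N :=
  \pi_(Quotient.quot (zmod_of_submod N)) x.

Lemma quot_piP (q : quot_module N) : exists x, q = quot_pi x.
Proof.
exists (repr (q : Quotient.quot (zmod_of_submod N))).
by rewrite /quot_pi; symmetry; apply: reprK.
Qed.

Lemma scale_quot_pi_eq0 r x : r *: quot_pi x = 0 <-> r *: x \in N.
Proof.
rewrite -[r *: quot_pi x]/(quot_scale r (quot_pi x)) pi_scale.
have -> : (0 : quot_module N) = quot_pi 0.
  by symmetry; apply: (raddf0 (\pi_(Quotient.quot (zmod_of_submod N)))).
rewrite -[r *: x in X in _ <-> X]subr0 -[_ - 0 \in N]/(_ \in zmod_of_submod N).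
by rewrite Quotient.idealrBE; split=> /eqP.
Qed.

Lemma associated_prime_quot (P : prime_idealr R) x :
  (forall r, r *: x \in N <-> r \in P) -> associated_prime (quot_module N) P.
Proof.
move=> xP; split.
- split; [exact: idealr0|by rewrite idealr1|].
  by move=> a u v uP vP; rewrite rpredD ?idealMr.
- by move=> u v; rewrite prime_idealrM.
- by exists (quot_pi x) => r; rewrite scale_quot_pi_eq0 xP.
Qed.

End QuotientModuleTheory.

(** If every element of [P] were nilpotent on [M] locally at [P], [nilpotent_socle] would apply to
    the ideal [I] of elements that locally annihilate [M]. It gives c outside [I] with Pc inside
    [I]; a common denominator s then makes [P] exactly the annihilator of the class of sc. *)
Lemma annihilator_nonnilpotent (R : comNzRingType) (M : lmodType R)
    (P : prime_idealr R) :
    noetherian R -> {subset annihilator M <= P} ->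
    ~ associated_prime (quot_module (annihilator M)) P ->
  exists2 w, w \in P &
    forall n s, s \notin P -> exists x : M, s *: (w ^+ n *: x) != 0.
Proof.
move=> noethR annP nassP; apply: contrapT => allnil.
have nil z : z \in P -> exists n s, s \notin P /\ z ^+ n * s \in annihilator M.
  move=> zP; apply: contrapT => zn; apply: allnil; exists z => // n s sP.
  apply: contrapT => zs; apply: zn; exists n, s; split=> //.
  apply/asboolP => x; apply: contrapT => /eqP zsx; apply: zs; exists x.
  by rewrite scalerA mulrC.
pose I : {pred R^o} := [pred r : R |
  `[< exists2 s, s \notin P & r * s \in annihilator M >]].
have Iclosed : subsemimod_closed I.
  split; first split.
  - apply/asboolP; exists 1; rewrite ?idealr1 // mul0r; exact: rpred0.
  - move=> a b /asboolP[s sP sa] /asboolP[t tP tb]; apply/asboolP.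
    exists (s * t); first by rewrite prime_idealrM negb_or sP.
    rewrite (_ : _ * _ = (t : R) *: (a * s : R^o) + (s : R) *: (b * t : R^o)).
      by apply: rpredD; apply: rpredZ.
    by rewrite /GRing.scale /=; ring.
  - move=> a b /asboolP[s sP sb]; apply/asboolP; exists s => //.
    rewrite -[a *: b]/((a : R) * b) -mulrA.
    exact: (@rpredZ _ _ (annihilator M) a).
have [||c cI cP] := @nilpotent_socle R (pack_submod Iclosed) P noethR.
- apply/negP => /asboolP[s sP]; rewrite mul1r => /annP.
  by rewrite (negPf sP).
- move=> z /nil[n [s [sP zs]]]; exists n; apply/asboolP; by exists s.
have [A PA] := noethR (pack_submod (idealr_submod P)).
pose K : {pred R^o} := [pred z : R | z * c \in annihilator M].
have Kclosed : subsemimod_closed K.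
  split; first split.
  - by rewrite inE mul0r; apply: rpred0.
  - by move=> a b; rewrite !inE mulrDl; apply: (@rpredD _ (annihilator M)).
  - move=> a b; rewrite !inE -[a *: b]/((a : R) * b) -mulrA.
    exact: (@rpredZ _ _ (annihilator M) a).
have [|s sP sA] := @gen_common_denom R P R^o A (pack_submod Kclosed).
  move=> z zA; have zP : z \in P by have := PA z => ->; apply: mem_gen.
  have /asboolP[s sP zcs] := cP z zP; exists s => //.
  by rewrite inE (_ : _ * c = z * c * s) // /GRing.scale /=; ring.
apply: nassP; apply: (@associated_prime_quot _ _ _ _ (s * c : R^o)) => r.
split=> [rsc|rP].
  apply: contrapT => /negP nrP; case/negP: cI; apply/asboolP.
  exists (r * s); first by rewrite prime_idealrM negb_or nrP.
  by rewrite mulrC -mulrA.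
have := sA r; have := PA r; rewrite [LHS]rP => <- /(_ isT).
by rewrite inE (_ : _ * c = r *: (s * c : R^o)) // /GRing.scale /=; ring.
Qed.

(** * A local generator of M and of pM *)

Section LocalStructure.
Variables (R : comNzRingType) (M : lmodType R) (N : submodClosed M).
Variable P : prime_idealr R.
Hypothesis noethR : noetherian R.
Hypothesis fgM : fin_gen_module M.
Hypothesis PE : P =i radical (colon N).
Hypothesis siN : strongly_irreducible N.

Lemma scaled_colon_closed c :
  subsemimod_closed ([pred r : R | `[< forall x : M, r *: (c *: x) \in N >]]
                       : {pred R^o}).
Proof.
split; first split.
- by apply/asboolP => x; rewrite scale0r rpred0.
- move=> a b /asboolP ha /asboolP hb; apply/asboolP => x.
  by rewrite scalerDl rpredD.
- move=> a b /asboolP hb; apply/asboolP => x.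
  by rewrite -[a *: b]/((a : R) * b) -scalerA rpredZ.
Qed.

Lemma scaled_colon_socle c x0 : c *: x0 \notin N ->
  exists d x, d *: (c *: x) \notin N /\
    forall z, z \in P -> forall y, (z * d) *: (c *: y) \in N.
Proof.
move=> cx0N.
have [||d dI dP] :=
  @nilpotent_socle R (pack_submod (scaled_colon_closed c)) P noethR.
- by apply/negP => /asboolP/(_ x0); rewrite scale1r; apply/negP.
- move=> z; rewrite PE => /radical_exp[n zn]; exists n; apply/asboolP => x.
  exact: zn.
move/asboolPn: dI => /existsNP[x /negP dxN].
by exists d, x; split=> // z /dP/asboolP.
Qed.

(* Over the local ring at P this says: every submodule not contained in
   (N : c) contains ((N : c) : P). *)
Definition dominated c := forall y, c *: y \notin N ->
  forall x, (forall w, w \in P -> w *: (c *: x) \in N) -> loc_mult P x y.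

(** If x outside [N] is sent into [N] by [P] and is not a local multiple of y, then rx = r'y forces
    r into [P], so the cyclic submodules of x and y meet inside [N]. Strong irreducibility then puts
    x or y in [N]. *)
Lemma dominated1 : dominated 1.
Proof.
move=> y; rewrite scale1r => yN.
have outN x : x \notin N -> (forall w, w \in P -> w *: x \in N) ->
    loc_mult P x y.
  move=> xN xP; apply: contrapT => nxy.
  have [|sub|sub] := siN (K := multiples x) (L := multiples y).
  - move=> _ /andP[/asboolP[r ->] /asboolP[r' e]].
    have [rP|rP] := boolP (r \in P); first exact: xP.
    by case: nxy; exists r => //; exists r'.
  - by move: xN; rewrite sub ?multiples_id.
  - by move: yN; rewrite sub ?multiples_id.
move=> x xP; have {}xP w : w \in P -> w *: x \in N.
  by move=> wP; rewrite -[x]scale1r xP.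
have [xN|xN] := boolP (x \in N); last exact: outN.
(* An x inside [N] is the difference of x + d x1 and d x1, both outside [N] and sent into [N] by
   [P]. *)
have [|d [x1 [dN dP]]] := @scaled_colon_socle 1 y; first by rewrite scale1r.
rewrite scale1r in dN.
have {}dP w : w \in P -> w *: (d *: x1) \in N.
  by move=> wP; have := dP w wP x1; rewrite scale1r scalerA.
rewrite -[x](addrK (d *: x1)); apply: loc_multB; last exact: outN.
apply: outN.
  apply: contra dN => sumN; rewrite -[d *: x1](addKr x) -scaleN1r.
  by rewrite rpredD ?rpredZ.
by move=> w wP; rewrite scalerDr rpredD ?dP ?xP.
Qed.

Variable w : R.
Hypothesis wP : w \in P.
Hypothesis w_nonnil :
  forall n s, s \notin P -> exists x : M, s *: (w ^+ n *: x) != 0.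

(** Finite generation of [M] would merge denominators depending on x into a single one, which
    [w_nonnil] excludes. *)
Lemma nonnil_local n :
  ~ forall x : M, exists2 s, s \notin P & s *: (w ^+ n *: x) = 0.
Proof.
move=> kill; have [A MA] := fgM.
pose K : {pred M} := [pred x | w ^+ n *: x == 0].
have Kclosed : subsemimod_closed K.
  split; first split.
  - by rewrite inE scaler0.
  - by move=> x y; rewrite !inE scalerDr => /eqP-> /eqP->; rewrite addr0.
  - move=> a x; rewrite !inE scalerA mulrC -scalerA => /eqP->.
    by rewrite scaler0.
have [|s sP sA] := @gen_common_denom R P M A (pack_submod Kclosed).
  move=> x _; have [s sP e] := kill x; exists s => //.
  by rewrite inE scalerA mulrC -scalerA e.
have [x /eqP[]] := w_nonnil n sP.
have /sA : x \in gen [in A] by have := MA x => <-.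
by rewrite inE scalerA mulrC -scalerA => /eqP.
Qed.

Lemma dominated_mul c z y0 : dominated c -> (z * c) *: y0 \notin N ->
  dominated (z * c).
Proof.
move=> domc _ y zyN x xP.
have zyN' : c *: (z *: y) \notin N by rewrite scalerA mulrC.
have cyN : c *: y \notin N.
  by apply: contra zyN => cyN; rewrite -scalerA rpredZ.
have [s sP [r e]] : loc_mult P (z *: x) (z *: y).
  by apply: domc => // v vP; rewrite [c *: _]scalerA [c * z]mulrC xP.
(* Domination by c gives s z x = r z y, so u = sx - ry is killed by z, and x is a local multiple of
   y as soon as u is. *)
suff uy : loc_mult P (s *: x - r *: y) y.
  apply: loc_mult_trans (loc_mult_unit x sP) _.
  have -> : s *: x = s *: x - r *: y - (- r) *: y.
    by rewrite scaleNr opprK subrK.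
  by apply: loc_multB uy _; apply: loc_mult_multiple.
have zu : z *: (s *: x - r *: y) = 0.
  by rewrite scalerBr !scalerA ![z * _]mulrC -!scalerA e subrr.
move: (s *: x - r *: y) zu => u zu.
apply: (domc) => // v vP; apply: rpredZ.
(* It remains to see that cu is in [N]. Otherwise, with w^n M inside [N], each w^n v' is a local
   multiple of u, so z w^n v' vanishes locally. *)
apply: contrapT => /negP cuN.
have [n wn] : exists n, forall x, w ^+ n *: x \in N.
  by apply: radical_exp; rewrite -PE.
have zw0 (v' : M) : exists2 s, s \notin P & s *: (z *: (w ^+ n *: v')) = 0.
  have [|t tP [a ea]] := domc u cuN (w ^+ n *: v').
    by move=> b _; do 2 apply: rpredZ.
  exists t => //; rewrite scalerA [t * z]mulrC -scalerA ea.
  by rewrite scalerA [z * a]mulrC -scalerA zu scaler0.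
(* As w^n v' is also a local multiple of zy, w^(2n) v' is one of z w^n y, which vanishes locally. *)
apply: (@nonnil_local (n + n)) => v'.
have [|t tP [a ea]] := domc _ zyN' (w ^+ n *: v').
  by move=> b _; do 2 apply: rpredZ.
have [t' t'P t'0] := zw0 y.
exists (t' * t); first exact: notin_primeM.
have -> : (t' * t) *: (w ^+ (n + n) *: v')
    = (t' * w ^+ n) *: (t *: (w ^+ n *: v')).
  by rewrite exprD !scalerA; congr (_ *: _); ring.
rewrite ea !scalerA (_ : _ * z = a * (t' * (z * w ^+ n))); last by ring.
by rewrite -!scalerA t'0 scaler0.
Qed.

(** Take (N : cM) maximal among dominated c with PcM not inside [N]. If uvcx were outside [N] for u,
    v in [P], then vc would qualify too. But a socle element d modulo (N : cM) lies in (N : vcM) and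
    not in (N : cM), against maximality. *)
Lemma maximal_dominated : ~ {subset ideal_mul P (predT : {pred M}) <= N} ->
  exists c y z, [/\ dominated c, z \in P, (z * c) *: y \notin N &
    forall v, v \in P -> forall u, u \in P ->
      forall x, u *: ((v * c) *: x) \in N].
Proof.
move=> PMN.
pose F c := dominated c /\ exists z y, z \in P /\ (z * c) *: y \notin N.
have F1 : F 1.
  split; first exact: dominated1.
  apply: contrapT => noz; apply: PMN.
  apply: gen_sub => _ /asboolP[z [y [zP _ ->]]].
  apply: contrapT => /negP zyN; apply: noz.
  by exists z, y; rewrite mulr1.
have [|c [domc [z [y [zP zyN]]]] cmax] :=
  @noetherian_maximal R R F _ noethR (fun c _ => scaled_colon_closed c).
  by exists 1.
exists c, y, z; split=> // v vP u uP x.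
have [//|vxN] := boolP (u *: ((v * c) *: x) \in N).
have vxN' : (v * c) *: x \notin N by apply: contra vxN; apply: rpredZ.
have cxN : c *: x \notin N.
  by apply: contra vxN' => cxN; rewrite -scalerA rpredZ.
have Fvc : F (v * c).
  by split; [apply: dominated_mul vxN'|exists u, x; rewrite -scalerA].
have [d [x' [dN dP]]] := scaled_colon_socle cxN.
case/negP: dN.
have: d \in [pred r : R | `[< forall x : M, r *: (c *: x) \in N >]].
  apply: (cmax _ Fvc) => [r /asboolP rN|]; apply/asboolP => x''.
    by rewrite [v * c]mulrC -[(c * v) *: _]scalerA.
  have := dP v vP x''; rewrite !scalerA; congr (_ \in N).
  by congr (_ *: _); ring.
by move=> /asboolP dcN; apply: dcN.
Qed.

(** Both zc and c are dominated. As [P] sends zcM into [N] while zcy is outside, every x is a local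
    multiple of y. As [P] sends cvx into [N] while czy is outside, vx is one of zy. *)
Lemma local_generator : ~ {subset ideal_mul P (predT : {pred M}) <= N} ->
  exists y z, [/\ z \in P, forall x : M, loc_mult P x y &
    forall v (x : M), v \in P -> loc_mult P (v *: x) (z *: y)].
Proof.
move=> /maximal_dominated[c [y [z [domc zP zyN Pc]]]].
exists y, z; split=> // [x|v x vP].
  by apply: (dominated_mul domc zyN zyN) => u uP; apply: Pc.
apply: domc => [|u uP]; first by rewrite scalerA mulrC.
by rewrite [c *: _]scalerA [c * v]mulrC Pc.
Qed.

End LocalStructure.

(** * The valuation defined by the generators *)

Section Valuation.
Variables (R : comNzRingType) (M : lmodType R).
Variable P : prime_idealr R.
Hypothesis noethR : noetherian R.
Variables (y : M) (z : R).
Hypothesis zP : z \in P.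
Hypothesis genM : forall x : M, loc_mult P x y.
Hypothesis genPM : forall v (x : M), v \in P -> loc_mult P (v *: x) (z *: y).

(** Nakayama for a cyclic module: sx = azx means that s - az, which is outside [P], kills x. Being a
    local multiple of 0 is vanishing in the localization. *)
Lemma loc_mult_fix (x : M) : loc_mult P x (z *: x) -> loc_mult P x 0.
Proof.
move=> [s sP [a e]]; exists (s - a * z).
  apply: contra sP => saP; rewrite -(subrK (a * z) s) rpredD //.
  exact: idealMr.
by exists 0; rewrite scalerBl -scalerA e subrr scaler0.
Qed.

(** Noetherian induction on the ideal of r for which ry is a local multiple of x. A counterexample x
    is locally zay for some a, so ay is a counterexample with at least as large an ideal. *)
Lemma valuation (x : M) : loc_mult P x 0 \/
  exists n, loc_mult P x (z ^+ n *: y) /\ loc_mult P (z ^+ n *: y) x.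
Proof.
apply: contrapT => badx.
pose bad (x : M) := ~ (loc_mult P x 0 \/
  exists n, loc_mult P x (z ^+ n *: y) /\ loc_mult P (z ^+ n *: y) x).
pose I (x : M) : {pred R^o} := [pred r : R | `[< loc_mult P (r *: y) x >]].
have [||x1 {badx} badx xmax] := @noetherian_maximal R M bad I noethR.
- move=> x' _; split; first split.
  + apply/asboolP; exists 1; first by rewrite idealr1.
    by exists 0; rewrite !scale0r scaler0.
  + move=> a b /asboolP ax /asboolP bx; apply/asboolP.
    rewrite -[b]opprK scalerDl scaleNr; apply: loc_multB ax _.
    rewrite -mulN1r -scalerA.
    exact: loc_mult_trans (loc_mult_multiple _ _ _) bx.
  + move=> a b /asboolP bx; apply/asboolP.
    rewrite -[a *: b]/((a : R) * b) -scalerA.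
    exact: loc_mult_trans (loc_mult_multiple _ _ _) bx.
- by exists x.
move: x1 badx xmax => {}x badx xmax.
have [s sP [r e]] := genM x.
have [rP|rP] := boolP (r \in P); last first.
  apply: badx; right; exists 0; rewrite expr0 scale1r; split; first exact: genM.
  by exists r => //; exists s.
have [t tP [a ea]] := genPM y rP.
have xz : (t * s) *: x = z *: (a *: y).
  by rewrite -scalerA e ea !scalerA mulrC.
have xzl : loc_mult P x (z *: (a *: y)).
  by rewrite -xz; apply: loc_mult_unit; apply: notin_primeM.
have xzr : loc_mult P (z *: (a *: y)) x.
  by rewrite -xz; apply: loc_mult_multiple.
have badx' : bad (a *: y).
  move=> [x'0|[n [x'n nx']]]; apply: badx; [left|right].
    by apply: loc_mult_trans (xzl) _; rewrite -(scaler0 _ z); apply: loc_multZ.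
  exists n.+1; rewrite exprS -scalerA.
  by split; [apply: loc_mult_trans (xzl) _|apply: loc_mult_trans _ xzr];
    apply: loc_multZ.
(* Maximality at x makes ay a local multiple of x, hence of zay, so ay vanishes locally. *)
apply: (badx'); left; apply: loc_mult_fix.
apply: loc_mult_trans (xzl); apply/asboolP.
apply: (xmax (a *: y)) => //; last by apply/asboolP; apply: loc_mult_refl.
move=> r' /asboolP r'x; apply/asboolP; apply: loc_mult_trans r'x _.
by apply: loc_mult_trans (xzl) _; apply: loc_mult_multiple.
Qed.

Lemma generator_comparable : comparable_at P M.
Proof.
have zero x x' : loc_mult P x 0 -> loc_mult P x x'.
  move/loc_mult_trans; apply; exists 1; first by rewrite idealr1.
  by exists 0; rewrite scaler0 scale0r.
have le i j : (i <= j)%N -> loc_mult P (z ^+ j *: y) (z ^+ i *: y).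
  by move=> /subnK <-; rewrite exprD -scalerA; apply: loc_mult_multiple.
move=> x x'; have [/zero|[i [xi ix]]] := valuation x; first by left.
have [/zero|[j [x'j jx']]] := valuation x'; first by right.
case: (leqP i j) => [ij|/ltnW ji]; [right|left].
  exact: loc_mult_trans x'j (loc_mult_trans (le _ _ ij) ix).
exact: loc_mult_trans xi (loc_mult_trans (le _ _ ji) jx').
Qed.

Lemma ideal_pow_generator n a (x : M) : a \in ideal_pow P n ->
  loc_mult P (a *: x) (z ^+ n *: y).
Proof.
elim: n a x => [|n IH] a x.
  by move=> _; rewrite expr0 scale1r; apply: genM.
move=> aP.
pose K : {pred R^o} :=
  [pred b : R | `[< forall x : M, loc_mult P (b *: x) (z ^+ n.+1 *: y) >]].
have Kclosed : subsemimod_closed K.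
  split; first split.
  - apply/asboolP => x'; exists 1; first by rewrite idealr1.
    by exists 0; rewrite !scale0r scaler0.
  - move=> b c /asboolP hb /asboolP hc; apply/asboolP => x'.
    rewrite -[c]opprK scalerDl scaleNr; apply: loc_multB => //.
    by rewrite -mulN1r mulrC -scalerA; apply: hc.
  - move=> b c /asboolP hc; apply/asboolP => x'.
    by rewrite -[b *: c]/((b : R) * c) mulrC -scalerA; apply: hc.
have : a \in pack_submod Kclosed.
  move: aP; apply: gen_sub => _ /asboolP[v [b [vP bP ->]]]; apply/asboolP => x'.
  rewrite -[v *: b]/(v * (b : R)) -scalerA.
  apply: loc_mult_trans (loc_multZ v (IH _ x' bP)) _.
  rewrite scalerA [v * _]mulrC exprSr -!scalerA.
  exact/loc_multZ/genPM.
by move=> /asboolP.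
Qed.


Lemma mem_ideal_pow n : z ^+ n \in ideal_pow P n.
Proof.
elim: n => [|n IH] //; apply: mem_gen; apply/asboolP.
by exists z, (z ^+ n); split=> //; rewrite exprS.
Qed.

(** [P] is the annihilator of the class of y: if r outside [P] sent y into PM, then y would be a
    local multiple of zy and so vanish locally. *)
Lemma generator_associated : ~ loc_mult P y 0 ->
  associated_prime (quot_module (ideal_mul P (predT : {pred M}))) P.
Proof.
move=> y0; apply: (@associated_prime_quot _ _ _ _ y) => r; split=> [rPM|rP].
  apply: contrapT => /negP rP; apply/y0/loc_mult_fix.
  apply: loc_mult_trans (loc_mult_unit y rP) _.
  pose K : {pred M} := [pred x | `[< loc_mult P x (z *: y) >]].
  have Kclosed : subsemimod_closed K.
    split; first split.
    - apply/asboolP; exists 1; first by rewrite idealr1.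
      by exists 0; rewrite scale0r scaler0.
    - move=> u v /asboolP hu /asboolP hv; apply/asboolP.
      rewrite -[v]opprK; apply: loc_multB => //; rewrite -scaleN1r.
      exact: loc_mult_trans (loc_mult_multiple _ _ _) hv.
    - move=> a u /asboolP hu; apply/asboolP.
      exact: loc_mult_trans (loc_mult_multiple _ _ _) hu.
  suff: r *: y \in pack_submod Kclosed by move/asboolP.
  move: rPM; apply: gen_sub => _ /asboolP[v [x [vP _ ->]]]; apply/asboolP.
  exact: genPM.
by apply: mem_gen; apply/asboolP; exists r, y.
Qed.

(** Every associated prime of M/PM contains [P], because [P] kills that module. As [P] is itself
    associated, it is the only minimal one. *)
Lemma symbolic_denomE s : ~ loc_mult P y 0 ->
  symbolic_denom M P s <-> s \notin P.
Proof.
move=> /generator_associated assP.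
have subq q :
    associated_prime (quot_module (ideal_mul P (predT : {pred M}))) q ->
  {subset P <= q}.
  move=> [_ _ [u uq]] v vP; apply/uq; have [x ->] := quot_piP u.
  by apply/scale_quot_pi_eq0; apply: mem_gen; apply/asboolP; exists v, x.
split=> [|sP q [qass qmin]].
  by apply; split=> // q qass qP r; apply/idP/idP => [/qP|/(subq q qass)].
by rewrite -(qmin _ assP (subq q qass)).
Qed.

(** The exponent is the least n with z^n M inside [N]. Locally both [N] and P^n M are generated by
    z^n y, and primarity of [N] removes the denominators. *)
Lemma generator_symbolic (N : submodClosed M) :
    P =i radical (colon N) -> primary N ->
    ~ {subset ideal_mul P (predT : {pred M}) <= N} ->
  exists n, (1 < n)%N /\ N =i symbolic_power M P n.
Proof.
move=> PE prN PMN.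
have [x0 x0N] := prN.1.
have memN x x' := @loc_mult_mem _ _ _ _ x x' PE prN.
have y0 : ~ loc_mult P y 0.
  move=> y0; case/negP: x0N.
  exact: memN (loc_mult_trans (genM x0) y0) (rpred0 _).
have exn : exists n, `[< forall x, z ^+ n *: x \in N >].
  by have := zP; rewrite PE => /radical_exp[n zn]; exists n; apply/asboolP.
case: (ex_minnP exn) => n /asboolP zn nmin; exists n; split.
  (* n = 0 would make [N] all of [M]; n = 1 would put PM inside [N], since its generators are local
     multiples of zy. *)
  case: n zn {nmin} => [|[|//]] zn.
    by case/negP: x0N; rewrite -[x0]scale1r -(expr0 z) zn.
  case: PMN; apply: gen_sub => _ /asboolP[v [x [vP _ ->]]].
  by apply: memN (genPM x vP) _; rewrite -[z]expr1.
move=> x; apply/idP/asboolP => [xN|[s /(symbolic_denomE _ y0) sP sx]].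
  case: (valuation x) => [[s sP [r e]]|[j [[s sP [r e]] jx]]].
    exists s; first exact/symbolic_denomE.
    by rewrite e scaler0; apply: rpred0.
  (* x in [N] puts z^j y in [N], hence z^j M too because y generates [M] locally. *)
  have nj : (n <= j)%N.
    apply: nmin; apply/asboolP => x'; apply: memN (memN _ _ jx xN).
    exact/loc_multZ/genM.
  exists s; first exact/symbolic_denomE.
  rewrite e -(subnK nj) exprD -scalerA; do 2 apply: rpredZ.
  apply: mem_gen; apply/asboolP; exists (z ^+ n), y; split=> //.
  exact: mem_ideal_pow.
apply: (primary_cancel PE prN sP); move: sx.
apply: gen_sub => _ /asboolP[a [x' [aP _ ->]]].
exact: memN (ideal_pow_generator x' aP) (zn y).
Qed.

End Valuation.

(** * Strong irreducibility in terms of symbolic powers *)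

Theorem theorem1p3 (R : comNzRingType) (M : lmodType R) (N : submodClosed M)
    (noethR : noetherian R) (fgM : fin_gen_module M)
    (pM_not_sub : ~ {subset ideal_mul (radical (colon N)) predT <= N})
    (p_not_ass : ~ associated_prime (quot_module (annihilator M))
                                    (radical (colon N))) :
  strongly_irreducible N <->
  [/\ primary N,
      exists P : prime_idealr R,
        P =i radical (colon N) /\ arithmetical (localization P M)
    & exists n : nat,
        (1 < n)%N /\ N =i symbolic_power M (radical (colon N)) n].
Proof.
split=> [siN|[prN [P [PE /arithmetical_localization cmpM]] _]]; last first.
  exact: comparable_strongly_irreducible prN PE cmpM.
have propN : exists x, x \notin N.
  apply: contrapT => allN; apply: pM_not_sub => x _.
  by apply: contrapT => /negP xN; apply: allN; exists x.
have prN := strongly_irreducible_primary noethR fgM propN siN.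
have [idealP primeP] := primary_radical_closed prN.
(* [P] is packed on the predicate [radical (colon N)] itself, so the two agree by computation. *)
pose P : prime_idealr R := HB.pack_for (prime_idealr R) (radical (colon N))
  (isIdealr.Build R (radical (colon N)) idealP)
  (isPrimeIdealrClosed.Build R (radical (colon N)) primeP).
have annP : {subset annihilator M <= P}.
  move=> r /asboolP rM; apply/asboolP; exists 1; apply/asboolP => x.
  by rewrite expr1 rM rpred0.
have [w wP w_nonnil] :=
  @annihilator_nonnilpotent R M P noethR annP p_not_ass.
have [//|y [z [zP genM genPM]]] :=
  @local_generator R M N P noethR fgM _ siN w wP w_nonnil pM_not_sub.
split=> //.
  exists P; split=> //; apply/arithmetical_localization.
  exact: (generator_comparable noethR zP genM genPM).
exact: (generator_symbolic (P := P) noethR zP genM genPM).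
Qed.
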